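(* For every smooth projective variety $X$ over $\mathbb{C}$ with $\dim X>0$ and every integer $n\ge 3$, there does not exist a birational projective morphism $$f\colon X^n=\underbrace{X\times X\times\cdots\times X}_{n}\to Y$$ to a projective variety $Y$ such that $f$ maps $\Delta_{ij}$ to a point for all $1\le i<j\le n$, where $$\Delta_{ij}=\{p\in X^n:\pi_i(p)=\pi_j(p)\}$$ and $\pi_i\colon X^n\to X$ is the $i$-th projection.
   Context: All varieties are over $\mathbb{C}$, reduced and irreducible. *)

(* Defs.v *)
From HB Require Import structures.
From mathcomp Require Import all_boot all_order all_algebra.
From mathcomp Require Import mpoly.
From mathcomp Require Import boolp classical_sets.

Set Implicit Arguments.
Unset Strict Implicit.
Unset Printing Implicit Defensive.

Import GRing.Theory.

Local Open Scope ring_scope.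
Local Open Scope classical_set_scope.

(* Varieties in the classical sense: irreducible Zariski closed subsets of     *)
(* projective space over an algebraically closed field K, considered with      *)
(* their K-rational points, topology and regular functions (this category is   *)
(* equivalent to that of integral projective K-schemes).                       *)

(* The projective space of lines in K^m; its dimension is m.-1, and it is      *)
(* empty for m = 0.                                                            *)
Definition proj (K : fieldType) (m : nat) : Type :=
  {L : {vspace 'rV[K]_m} | \dim L == 1%N}.

Section Points.
Variables (K : fieldType) (m : nat).

Definition hcoord (x : proj K m) : 'rV[K]_m := vpick (val x).

Lemma hcoord_neq0 (x : proj K m) : hcoord x != 0.
Proof. by rewrite /hcoord vpick0 -dimv_eq0 (eqP (valP x)). Qed.

Lemma dim_vline_neq0 (v : 'rV[K]_m) : v != 0 -> \dim <[v]>%VS == 1%N.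
Proof. by move=> nz_v; rewrite dim_vline nz_v. Qed.

Definition pt (v : 'rV[K]_m) (nz_v : v != 0) : proj K m :=
  Sub <[v]>%VS (dim_vline_neq0 nz_v).

Lemma val_hcoord (x : proj K m) : val x = <[hcoord x]>%VS.
Proof.
apply/esym/eqP; rewrite eqEdim -memvE memv_pick dim_vline hcoord_neq0.
by rewrite (eqP (valP x)).
Qed.

Lemma hcoord_pt (v : 'rV[K]_m) (nz_v : v != 0) :
  exists2 c : K, c != 0 & hcoord (pt nz_v) = c *: v.
Proof.
have /vlineP[c hc] : hcoord (pt nz_v) \in <[v]>%VS by exact: memv_pick.
exists c => //; apply: contraNneq (hcoord_neq0 (pt nz_v)) => c0.
by rewrite hc c0 scale0r.
Qed.

(* Evaluation at one choice of homogeneous coordinates of x. It is used below  *)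
(* only for homogeneous p, in ways that do not depend on this choice.          *)
Definition hval (p : {mpoly K[m]}) (x : proj K m) : K :=
  p.@[fun j => hcoord x 0 j].

End Points.

Section Zariski.
Variables (K : closedFieldType) (m : nat).
Implicit Types (A U Z X : set (proj K m)).

Definition zariski_closed Z : Prop :=
  exists S : set {mpoly K[m]},
    (forall p, S p -> exists d : nat, p \is d.-homog) /\
    Z = [set x | forall p, S p -> hval p x = 0].

Definition zariski_open U : Prop := zariski_closed (~` U).

Definition irreducible Z : Prop :=
  Z !=set0 /\
  forall A B, zariski_closed A -> zariski_closed B ->
    Z `<=` A `|` B -> Z `<=` A \/ Z `<=` B.

Definition projective_variety X : Prop := zariski_closed X /\ irreducible X.

(* Z 0 `<` ... `<` Z e, irreducible closed subsets of the closed set X *)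
Definition irreducible_chain X (e : nat) : Prop :=
  exists Z : nat -> set (proj K m),
    (forall i, (i <= e)%N ->
       [/\ zariski_closed (Z i), irreducible (Z i) & Z i `<=` X]) /\
    (forall i, (i < e)%N -> Z i `<` Z i.+1).

Definition dimension X (d : nat) : Prop :=
  irreducible_chain X d /\ forall e, irreducible_chain X e -> (e <= d)%N.

(* T is the linear subspace of K^m whose projectivization is the embedded      *)
(* projective tangent space of X at x: the common kernel of the differentials  *)
(* at x of all homogeneous equations of X.                                     *)
Definition is_tangent_space X (x : proj K m) (T : {vspace 'rV[K]_m}) : Prop :=
  forall v : 'rV[K]_m, v \in T <->
    forall (d : nat) (p : {mpoly K[m]}), p \is d.-homog ->
      (forall y, X y -> hval p y = 0) ->
      \sum_(j < m) hval (mderiv j p) x * v 0 j = 0.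

(* Jacobian criterion in homogeneous form: at every point the equations of X   *)
(* have Jacobian rank m - (d + 1), i.e. the codimension of X.                  *)
Definition smooth X : Prop :=
  exists d : nat, dimension X d /\
    forall x, X x ->
      exists T : {vspace 'rV[K]_m}, is_tangent_space X x T /\ \dim T = d.+1.

(* phi is a regular function on the locally closed set A (values of phi        *)
(* outside A are irrelevant).                                                  *)
Definition regular A (phi : proj K m -> K) : Prop :=
  forall x, A x ->
    exists U, zariski_open U /\ U x /\
    exists (d : nat) (g h : {mpoly K[m]}),
      [/\ g \is d.-homog, h \is d.-homog &
          forall y, A y -> U y -> hval h y != 0 /\ phi y = hval g y / hval h y].

End Zariski.

Section Morphisms.
Variable K : closedFieldType.

(* Morphism between locally closed sets A and B: a continuous map that pulls   *)
(* regular functions back to regular functions. Maps are total; only their     *)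
(* values on A matter.                                                         *)
Definition morphism (m k : nat) (A : set (proj K m)) (B : set (proj K k))
    (f : proj K m -> proj K k) : Prop :=
  [/\ forall x, A x -> B (f x),
      forall Z, zariski_closed Z ->
        exists2 Z', zariski_closed Z' & A `&` f @^-1` Z = A `&` Z' &
      forall V phi, zariski_open V -> regular (B `&` V) phi ->
        regular (A `&` f @^-1` V) (phi \o f)].

Definition isomorphism (m k : nat) (A : set (proj K m)) (B : set (proj K k))
    (f : proj K m -> proj K k) : Prop :=
  morphism A B f /\
  exists g : proj K k -> proj K m,
    [/\ morphism B A g, forall x, A x -> g (f x) = x
      & forall y, B y -> f (g y) = y].

Definition birational (m k : nat) (X : set (proj K m)) (Y : set (proj K k))
    (f : proj K m -> proj K k) : Prop :=
  exists U V,
    [/\ zariski_open U, zariski_open V, X `&` U !=set0, Y `&` V !=set0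
      & isomorphism (X `&` U) (Y `&` V) f].

(* The binary Segre map *)
Section Segre2.
Variables a b : nat.

Definition segre2_vec (u : 'rV[K]_a) (v : 'rV[K]_b) : 'rV[K]_(a * b) :=
  mxvec (u^T *m v).

Lemma segre2_vec_neq0 u v : u != 0 -> v != 0 -> segre2_vec u v != 0.
Proof.
move=> /rV0Pn[i nz_i] /rV0Pn[j nz_j].
apply/rV0Pn; exists (mxvec_index i j).
by rewrite /segre2_vec mxvecE mxE big_ord1 !mxE mulf_neq0.
Qed.

Definition segre2 (x : proj K a) (y : proj K b) : proj K (a * b) :=
  pt (segre2_vec_neq0 (hcoord_neq0 x) (hcoord_neq0 y)).

End Segre2.

(* f : X -> Y is projective: it factors as a closed immersion                  *)
(* (g, f) : X -> P x Y, with P a projective space, followed by the projection  *)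
(* to Y; P x Y is viewed in projective space by the Segre embedding.           *)
Definition projective_morphism (m k : nat) (X : set (proj K m))
    (Y : set (proj K k)) (f : proj K m -> proj K k) : Prop :=
  morphism X Y f /\
  exists (a : nat) (g : proj K m -> proj K a) (Z : set (proj K (a * k))),
    zariski_closed Z /\ isomorphism X Z (fun x => segre2 (g x) (f x)).

End Morphisms.

Section Product.
Variables (K : closedFieldType) (n m : nat).

(* The homogeneous coordinates on the target of the Segre embedding            *)
(* (P^(m-1))^n -> P^(m^n - 1) are indexed by the maps 'I_n -> 'I_m.            *)
Definition segre_size : nat := #|{: {ffun 'I_n -> 'I_m}}|.

Definition segre_vec (v : 'I_n -> 'rV[K]_m) : 'rV[K]_segre_size :=
  \row_(t < segre_size) \prod_(i < n) v i 0 ((enum_val t) i).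

Lemma segre_vec_neq0 (v : 'I_n -> 'rV[K]_m) :
  (forall i, v i != 0) -> segre_vec v != 0.
Proof.
move=> nz_v; have /fin_all_exists[t nz_t] : forall i, exists j, v i 0 j != 0.
  by move=> i; apply/rV0Pn.
apply/rV0Pn; exists (enum_rank [ffun i => t i]).
rewrite mxE enum_rankK; apply/prodf_neq0 => i _.
by rewrite ffunE.
Qed.

Definition segre (x : 'I_n -> proj K m) : proj K segre_size :=
  pt (segre_vec_neq0 (fun i => hcoord_neq0 (x i))).

(* X^n as a subset of projective space *)
Definition prod_variety (X : set (proj K m)) : set (proj K segre_size) :=
  segre @` [set x | forall i, X (x i)].

(* The i-th projection, as a line in K^m: it is spanned by the vectors         *)
(* (z_(t[i := j]))_j, where the z_t are the homogeneous coordinates of p.      *)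
Definition slice (i : 'I_n) (t : {ffun 'I_n -> 'I_m}) (z : 'rV[K]_segre_size) :
    'rV[K]_m :=
  \row_(j < m) z 0 (enum_rank [ffun l => if l == i then j else t l]).

Definition projection (i : 'I_n) (p : proj K segre_size) :
    {vspace 'rV[K]_m} :=
  (\sum_(t : {ffun 'I_n -> 'I_m}) <[slice i t (hcoord p)]>)%VS.

Lemma slice_segre_vec i t (c : K) (v : 'I_n -> 'rV[K]_m) :
  slice i t (c *: segre_vec v) =
    (c * \prod_(l < n | l != i) v l 0 (t l)) *: v i.
Proof.
apply/rowP=> j; rewrite !mxE enum_rankK (bigD1 i) //= ffunE eqxx.
rewrite -mulrA; congr (_ * _); rewrite mulrC; congr (_ * _).
by apply: eq_bigr => l /negPf nli; rewrite ffunE nli.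
Qed.

Lemma projection_segre i (x : 'I_n -> proj K m) :
  projection i (segre x) = val (x i).
Proof.
rewrite /projection val_hcoord.
have [c nz_c ->] := hcoord_pt (segre_vec_neq0 (fun i => hcoord_neq0 (x i))).
apply/eqP; rewrite eqEsubv; apply/andP; split.
  apply/subv_sumP => t _; rewrite slice_segre_vec -memvE.
  by rewrite memvZ ?memv_line.
have /fin_all_exists[t nz_t] : forall l, exists j, hcoord (x l) 0 j != 0.
  by move=> l; apply/rV0Pn/hcoord_neq0.
apply: subv_trans (sumv_sup [ffun l => t l] _ (subvv _)) => //.
rewrite slice_segre_vec -memvE.
set b := _ * _; have nz_b : b != 0.
  rewrite mulf_neq0 //; apply/prodf_neq0 => l _.
  by rewrite ffunE.
by apply/vlineP; exists b^-1; rewrite scalerA mulVf ?scale1r.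
Qed.

Lemma segre_inj : injective segre.
Proof.
move=> x y eq_xy; apply/funext => i.
by apply/val_inj; rewrite -!projection_segre eq_xy.
Qed.

Definition pair_diagonal (X : set (proj K m)) (i j : 'I_n) :
    set (proj K segre_size) :=
  [set p | prod_variety X p /\ projection i p = projection j p].

End Product.

Arguments prod_variety {K} n {m} X.

(* Main.v *)
Require Import Defs.
From HB Require Import structures.
From mathcomp Require Import all_boot all_order all_algebra.
From mathcomp Require Import complex mpoly.
From mathcomp Require Import boolp classical_sets reals.
From mathcomp Require Import finmap cardinality constructive_ereal.
From mathcomp Require lebesgue_measure.

(** The theorem follows from the rigidity lemma for morphisms out of a product
    of projective varieties. Let f contract every diagonal of X^n, n >= 3. All
    diagonals contain the small diagonal, so all of them go to one point y. Fix
    the coordinates x_3, ..., x_n and put p = x_3: as a function of (x_1, x_2),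
    f sends X x {p} (part of the diagonal of the coordinates 2 and 3) and
    {p} x X (part of the diagonal of the coordinates 1 and 3) to y. Rigidity
    ([rigidity]) then forces f (x_1, x_2, x_3, ..., x_n) = y, so that f is
    constant. A constant map is injective on a nonempty open subset of X^n only
    if X is a point ([constant_not_birational]), against dim X > 0.

    Rigidity combines two facts on the projective variety X, namely that its
    regular functions are constant and that projections along it are closed.
    Both come from one integrality argument ([integral_near]). Take a linear
    form l vanishing at y and a coordinate l0 with l0 (y) <> 0; then
    phi = (l / l0) o f is locally a quotient of bihomogeneous forms in x_1 and
    x_2. The denominators of phi, restricted to x_1 = p, form a homogeneous
    ideal without zeros, hence contain all monomials e_j of some degree N by
    the homogeneous Nullstellensatz. Lifting these to denominators on X x X
    gives the matrix identity phi . e (x_2) P (x_1) = e (x_2) Q (x_1) with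
    P (p) = 1. Wherever det P (x_1) <> 0, that is near p, the values
    phi (x_1, x_2) are thus eigenvalues of a matrix depending on x_1 only. So
    phi (x_1, -) takes finitely many values, is constant because X is
    irreducible, and equals phi (x_1, p) = 0. Irreducibility in the variable x_1
    extends this from the neighbourhood of p to all of X.

    The Nullstellensatz ([weak_nullstellensatz]) is proved over an uncountable
    algebraically closed field, where it has a short proof: polynomials form a
    space of countable dimension, so that inverses of x_i - c, for uncountably
    many c, are linearly dependent modulo an ideal, which would make some
    polynomial in x_i both vanish and be invertible. *)

Set Implicit Arguments.
Unset Strict Implicit.
Unset Printing Implicit Defensive.
Import Order.TTheory GRing.Theory Num.Theory.
Local Open Scope ring_scope.
Local Open Scope complex_scope.
Local Open Scope classical_set_scope.

(** * Uncountability of the complex numbers *)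

Lemma uncountable_complex (R : realType) : ~ countable [set: R[i]].
Proof.
move=> /countable_injP[g /in2TT inj_g].
have cntI : countable [set` Interval (BLeft (0 : R)) (BRight 1)].
  apply/countable_injP; exists (fun x => g x%:C).
  by move=> x y _ _ /inj_g [].
have := lebesgue_measure.countable_lebesgue_measure0 cntI.
rewrite lebesgue_measure.lebesgue_measure_itv /= lte_fin ltr01 sube0.
by move/eqP; rewrite eqe oner_eq0.
Qed.

(** * Ideals and the weak Nullstellensatz *)

Section Ideals.
Variables (K : fieldType) (n : nat).
Implicit Types (J : set {mpoly K[n]}) (p q g : {mpoly K[n]}).

Record ideal J : Prop := Ideal {
  ideal0 : J 0;
  idealD : forall p q, J p -> J q -> J (p + q);
  idealM : forall a p, J p -> J (a * p)
}.

Lemma idealZ J c p : ideal J -> J p -> J (c *: p).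
Proof. by move=> idJ Jp; rewrite -mul_mpolyC; apply: idealM. Qed.

Lemma idealN J p : ideal J -> J p -> J (- p).
Proof. by move=> idJ Jp; rewrite -scaleN1r; apply: idealZ. Qed.

Lemma ideal_sum J (I : Type) (r : seq I) (F : I -> {mpoly K[n]}) :
  ideal J -> (forall i, J (F i)) -> J (\sum_(i <- r) F i).
Proof.
by move=> idJ JF; apply: big_ind => //; [exact: ideal0 | exact: idealD].
Qed.

Definition adjoin J g : set {mpoly K[n]} :=
  [set p | exists a q, J q /\ p = a * g + q].

Lemma ideal_adjoin J g : ideal J -> ideal (adjoin J g).
Proof.
move=> idJ; split.
- by exists 0, 0; split; [exact: ideal0 | rewrite mul0r addr0].
- move=> _ _ [a [q [Jq ->]]] [b [r [Jr ->]]].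
  by exists (a + b), (q + r); split; [exact: idealD | rewrite mulrDl addrACA].
- move=> b _ [a [q [Jq ->]]].
  by exists (b * a), (b * q); split; [exact: idealM | rewrite mulrDr mulrA].
Qed.

Lemma sub_adjoin J g : J `<=` adjoin J g.
Proof. by move=> q Jq; exists 0, q; rewrite mul0r add0r. Qed.

Lemma adjoin_generator J g : ideal J -> adjoin J g g.
Proof. by move=> idJ; exists 1, 0; rewrite mul1r addr0; split; first exact: ideal0. Qed.

End Ideals.

Lemma infinite_fiber (T : Type) (D : T -> nat) :
  ~ countable [set: T] -> exists k, infinite_set [set x | D x = k].
Proof.
move=> uncT; apply: contra_notP uncT => finD.
have -> : [set: T] = \bigcup_(k in [set: nat]) [set x | D x = k].
  by apply/seteqP; split=> // x _; exists (D x).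
apply: bigcup_countable => // k _; apply: finite_set_countable.
by apply: contrapT => infD; apply: finD; exists k.
Qed.

(** Polynomials of bounded degree form a finite-dimensional space, and some
    bound is shared by infinitely many members of the family. *)
Lemma uncountable_family_dependent (K : fieldType) (n : nat)
    (q : K -> {mpoly K[n]}) : ~ countable [set: K] ->
  exists (r : nat) (c : 'I_r -> K) (u : 'rV[K]_r),
    [/\ injective c, u != 0 & \sum_k u 0 k *: q (c k) = 0].
Proof.
move=> /(infinite_fiber (fun x => msize (q x)))[k inf_k].
pose M := #|{: 'X_{1..n < k}}|.
have [B sBk leMB] := infinite_set_fset M.+1 inf_k.
pose r := size (enum_fset B).
pose c (i : 'I_r) := nth 0 (enum_fset B) i.
have inj_c : injective c.
  by move=> i j /eqP; rewrite nth_uniq ?fset_uniq // => /eqP/val_inj.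
have size_qc i : msize (q (c i)) = k.
  by apply: (sBk (c i)) => /=; rewrite mem_nth.
pose A : 'M[K]_(r, M) := \matrix_(i, j) (q (c i))@_(enum_val j : 'X_{1..n < k}).
have ker_nz : kermx A != 0.
  rewrite kermx_eq0 /row_free neq_ltn (leq_ltn_trans (rank_leq_col A)) //.
have [i nz_u] : exists i, row i (kermx A) != 0.
  apply/existsP; rewrite -negb_forall; apply: contra ker_nz => /forallP ker0.
  by apply/eqP/row_matrixP=> i; rewrite row0; apply/eqP.
exists r, c, (row i (kermx A)); split=> //.
have /matrixP uA : row i (kermx A) *m A = 0 by rewrite -row_mul mulmx_ker row0.
apply/mpolyP=> m; rewrite mcoeff0 raddf_sum /=.
have [lt_mk|le_km] := ltnP (mdeg m) k; last first.
  rewrite big1 // => j _; rewrite mcoeffZ memN_msupp_eq0 ?mulr0 //.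
  by apply/negP => /msize_mdeg_lt; rewrite size_qc ltnNge le_km.
have := uA 0 (enum_rank (BMultinom lt_mk)); rewrite !mxE => {2}<-.
by apply: eq_bigr => j _; rewrite mcoeffZ [A _ _]mxE enum_rankK.
Qed.

Section Nullstellensatz.
Variables (K : closedFieldType) (n : nat).
Hypothesis uncountable_K : ~ countable [set: K].
Implicit Types J : set {mpoly K[n]}.

(** If every x_i - c had an inverse a_c modulo J, then a linear dependency
    between some a_{c_k} multiplied by the product of the x_i - c_k would put a
    nonzero polynomial g (x_i) into J. But g splits into factors x_i - r, all of
    them invertible modulo J, so J would contain 1. *)
Lemma adjoin_shift_proper J (i : 'I_n) : ideal J -> ~ J 1 ->
  exists c : K, ~ adjoin J ('X_i - c%:MP) 1.
Proof.
move=> idJ J1; apply: contrapT => no_c.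
have /choice[a Ja] : forall c, exists a, J (1 - a * ('X_i - c%:MP)).
  move=> c; have : adjoin J ('X_i - c%:MP) 1.
    by apply: contrapT => Jc; apply: no_c; exists c.
  by move=> [a [q [Jq eq1]]]; exists a; rewrite eq1 addrC addKr.
have [r [c [u [inj_c nz_u dep]]]] := uncountable_family_dependent a uncountable_K.
pose h : {poly K} -> {mpoly K[n]} := horner_alg ('X_i : {mpoly K[n]}).
have h_lin x : h ('X - x%:P) = 'X_i - x%:MP.
  by rewrite /h rmorphB /= horner_algX horner_algC alg_mpolyC.
have hZ x p : h (x *: p) = x *: h p by rewrite /h linearZ /= mulr_algl.
pose g : {poly K} := \sum_k u 0 k *: \prod_(l | l != k) ('X - (c l)%:P).
(* at c k all summands of g vanish except the k-th *)
have nz_g : g != 0.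
  have /rV0Pn[k nz_uk] := nz_u.
  apply: contraNneq nz_uk => g0.
  have := congr1 (horner^~ (c k)) g0; rewrite horner0 /g horner_sum.
  rewrite (bigD1 k) //= [X in _ + X]big1 => [|j njk]; last first.
    rewrite hornerZ horner_prod (bigD1 k) 1?eq_sym //=.
    by rewrite hornerXsubC subrr mul0r mulr0.
  rewrite addr0 hornerZ horner_prod => /eqP; rewrite mulf_eq0 => /orP[//|].
  rewrite prodf_seq_eq0 => /hasP[l _]; rewrite hornerXsubC subr_eq0.
  by case/andP=> nlk /eqP/inj_c eq_kl; rewrite eq_kl eqxx in nlk.
have Jg : J (h g).
  pose t := \prod_l ('X_i - (c l)%:MP : {mpoly K[n]}).
  have -> : h g = h g - (\sum_k u 0 k *: a (c k)) * t by rewrite dep mul0r subr0.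
  rewrite /g [h _]linear_sum mulr_suml -sumrB; apply: ideal_sum => // k.
  rewrite [X in X - _]hZ -scalerAl -scalerBr; apply: idealZ => //.
  rewrite [h _]rmorph_prod (eq_bigr _ (fun l _ => h_lin (c l))).
  rewrite [t](bigD1 k) //=; set t' := \prod_(_ | _) _.
  rewrite mulrA -{1}[t']mul1r -mulrBl mulrC.
  by apply: idealM.
have [rs def_g] := closed_field_poly_normal g.
have : J (\prod_(x <- rs) h ('X - x%:P)).
  have -> : \prod_(x <- rs) h ('X - x%:P) = (lead_coef g)^-1 *: h g.
    rewrite {2}def_g hZ scalerA mulVf ?lead_coef_eq0 // scale1r.
    by rewrite [h _]rmorph_prod.
  exact: idealZ.
elim: rs {def_g} => [|x rs IHrs]; first by rewrite big_nil.
rewrite big_cons h_lin; set t := \prod_(_ <- _) _ => Jt; apply: IHrs; rewrite -/t.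
have -> : t = t * (1 - a x * ('X_i - x%:MP)) + a x * (('X_i - x%:MP) * t).
  by rewrite mulrBr mulr1 mulrA [a x * _ * _]mulrC subrK.
by apply: (idealD idJ); apply: idealM.
Qed.

(** Once J is enlarged by all x_i - v_i and remains proper, each p is congruent
    to its value p (v) modulo J. *)
Theorem weak_nullstellensatz J : ideal J -> ~ J 1 ->
  exists v : 'I_n -> K, forall p, J p -> p.@[v] = 0.
Proof.
move=> idJ J1.
have [J' [v [idJ' J'1 sJJ' J'v]]] : exists J' (v : 'I_n -> K),
    [/\ ideal J', ~ J' 1, J `<=` J' &
        forall i, i \in enum 'I_n -> J' ('X_i - (v i)%:MP)].
  elim: (enum 'I_n) => [|i s [J' [v [idJ' J'1 sJJ' J'v]]]].
    by exists J, (fun=> 0); split.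
  have [c J'c] := adjoin_shift_proper i idJ' J'1.
  exists (adjoin J' ('X_i - c%:MP)), (fun j => if j == i then c else v j).
  split=> //; first exact: ideal_adjoin.
    by apply: subset_trans sJJ' _; apply: sub_adjoin.
  move=> j; rewrite inE; case: eqP => [-> _|_ /= sj].
    exact: adjoin_generator.
  exact/sub_adjoin/J'v.
have J'P p : J' (p - p.@[v]%:MP).
  elim/mpolyind: p => [|c m p _ _ IHp].
    by rewrite meval0 mpolyC0 subr0; apply: ideal0.
  rewrite mevalD mpolyCD opprD addrACA; apply: idealD IHp => //.
  rewrite mevalZ mpolyCM mul_mpolyC -scalerBr; apply: idealZ => //.
  rewrite mpolyXE_id.
  apply: (big_ind (fun p => J' (p - p.@[v]%:MP))) => [|f g J'f J'g|i _].
  - by rewrite meval1 subrr; apply: ideal0.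
  - have -> : f * g - (f * g).@[v]%:MP
        = g * (f - f.@[v]%:MP) + f.@[v]%:MP * (g - g.@[v]%:MP).
      by rewrite mevalM mpolyCM !mulrBr [g * f]mulrC [g * _%:MP]mulrC addrA subrK.
    by apply: idealD => //; apply: idealM.
  - elim: (m i) => [|k IHk]; first by rewrite expr0 meval1 subrr; apply: ideal0.
    have -> : 'X_i ^+ k.+1 - ('X_i ^+ k.+1).@[v]%:MP
        = 'X_i ^+ k * ('X_i - (v i)%:MP)
          + (v i)%:MP * ('X_i ^+ k - ('X_i ^+ k).@[v]%:MP).
      rewrite exprS mevalM mevalXU mpolyCM !mulrBr [_ ^+ k * 'X_i]mulrC.
      by rewrite [_ ^+ k * _%:MP]mulrC addrA subrK.
    by apply: idealD => //; apply: idealM => //; apply: J'v; rewrite mem_enum.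
exists v => p Jp; apply/eqP/negPn/negP => nz_pv; apply: J'1.
have J'pv : J' (p.@[v]%:MP).
  have -> : p.@[v]%:MP = p - (p - p.@[v]%:MP) by rewrite subKr.
  by apply: (idealD idJ'); [exact: sJJ' | exact: idealN].
have -> : 1 = (p.@[v])^-1 *: (p.@[v]%:MP : {mpoly K[n]}).
  by rewrite -mul_mpolyC -mpolyCM mulVf.
exact: idealZ.
Qed.

End Nullstellensatz.

(** * Homogeneous components and the homogeneous Nullstellensatz *)

Section Components.
Variables (R : comNzRingType) (n : nat).
Implicit Types p : {mpoly R[n]}.

Lemma mcoeff_pihomog d p m :
  (pihomog mdeg d p)@_m = if mdeg m == d then p@_m else 0.
Proof.
elim/mpolyind: p => [|c m' p _ _ IHp].
  by rewrite pihomog0 mcoeff0 if_same.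
rewrite pihomogD !mcoeffD IHp linearZ /= pihomogX !mcoeffZ mcoeffX.
case: (eqVneq m' m) => [->|/negPf ne_m']; first by case: ifP => _;
  rewrite ?mcoeffX ?eqxx // mcoeff0 mulr0 addr0.
rewrite mulr0 add0r; suff -> : (if mdeg m' == d then 'X_[m'] else 0)@_m = 0 :> R.
  by rewrite mulr0 add0r.
by case: ifP => _; rewrite ?mcoeffX ?ne_m' ?mcoeff0.
Qed.

Lemma pihomog_mulX d i p :
  pihomog mdeg d.+1 ('X_i * p) = 'X_i * pihomog mdeg d p.
Proof.
elim/mpolyind: p => [|c m p _ _ IHp]; first by rewrite mulr0 !pihomog0 mulr0.
rewrite mulrDr !pihomogD mulrDr IHp -scalerAr !linearZ /= -scalerAr.
rewrite -mpolyXD !pihomogX /= mdegD mdeg1 add1n eqSS; congr (_ *: _ + _).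
by case: ifP => _; rewrite ?mulr0 // mpolyXD.
Qed.

Lemma pihomog0_mulX i p : pihomog mdeg 0 ('X_i * p) = 0.
Proof.
elim/mpolyind: p => [|c m p _ _ IHp]; first by rewrite mulr0 pihomog0.
rewrite mulrDr pihomogD IHp addr0 -scalerAr linearZ /= -mpolyXD pihomogX /=.
by rewrite mdegD mdeg1 scaler0.
Qed.

Lemma pihomog_large d p : (msize p <= d)%N -> pihomog mdeg d p = 0.
Proof.
move=> le_pd; apply/mpolyP=> m; rewrite mcoeff_pihomog mcoeff0.
case: eqP => // mdE; apply: memN_msupp_eq0; apply/negP => /msize_mdeg_lt.
by rewrite mdE ltnNge le_pd.
Qed.

Lemma meval_homog d p (t : R) (v : 'I_n -> R) :
  p \is d.-homog -> p.@[fun i => t * v i] = t ^+ d * p.@[v].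
Proof.
move=> /dhomogP hom_p; rewrite !mevalE mulr_sumr big_seq [RHS]big_seq.
apply: eq_bigr => m /hom_p <-; rewrite mulrCA; congr (_ * _).
under eq_bigr do rewrite exprMn.
by rewrite big_split /= prodrXr -mdegE.
Qed.

Lemma meval_components N p (t : R) (v : 'I_n -> R) : (msize p <= N)%N ->
  p.@[fun i => t * v i] = \sum_(d < N) t ^+ d * (pihomog mdeg d p).@[v].
Proof.
move=> le_pN; rewrite {1}(pihomog_partitionE le_pN) raddf_sum /=.
by apply: eq_bigr => d _; rewrite (meval_homog _ _ (pihomogP _ _ _)).
Qed.

End Components.

(** The points of the hyperplane x_j = 1 are nonzero, hence J and x_j - 1
    generate the unit ideal: 1 = a (x_j - 1) + q with q in J. The homogeneous
    components of q are in J too, and with those of a they telescope to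
    x_j^N + a_N in J. Since a_N = 0 for large N, J contains a power of each
    variable. *)
Theorem homogeneous_nullstellensatz (K : closedFieldType) (n : nat)
    (J : set {mpoly K[n]}) :
    ~ countable [set: K] -> ideal J ->
    (forall p d, J p -> J (pihomog mdeg d p)) ->
    (forall v : 'I_n -> K, (exists i, v i != 0) -> exists2 p, J p & p.@[v] != 0) ->
  exists N, forall m : 'X_{1..n}, mdeg m = N -> J 'X_[m].
Proof.
move=> uncK idJ homJ noZ.
have /choice[N JN] : forall j : 'I_n, exists N, J ('X_j ^+ N).
  move=> j; have : adjoin J ('X_j - 1%:MP) 1.
    apply: contrapT => Jj1; have idJj := ideal_adjoin ('X_j - 1%:MP) idJ.
    have [v v0] := weak_nullstellensatz uncK idJj Jj1.
    have vj : v j = 1.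
      apply/eqP; rewrite -subr_eq0; have := v0 _ (adjoin_generator ('X_j - 1%:MP) idJ).
      by rewrite mevalB mevalXU mevalC => ->.
    have [|p Jp] := noZ v; first by exists j; rewrite vj oner_eq0.
    by rewrite v0 ?eqxx //; apply: sub_adjoin.
  move=> [a [q [Jq eq1]]].
  have def_q : q = 1 + a - 'X_j * a.
    have -> : q = 1 - a * ('X_j - 1%:MP) by rewrite {1}eq1 addrC addKr.
    by rewrite mpolyC1 mulrBr mulr1 opprB addrA [a * _]mulrC.
  have JX N : J ('X_j ^+ N + pihomog mdeg N a).
    elim: N => [|N IHN].
      have := homJ _ 0%N Jq; rewrite def_q pihomogB pihomogD pihomog0_mulX subr0.
      by rewrite (pihomog_dE (dhomog1 _ _)).
    have := homJ _ N.+1 Jq; rewrite def_q pihomogB pihomogD pihomog_mulX.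
    rewrite (pihomog_ne0 _ (dhomog1 _ _)) // add0r => Ja.
    have := idealD idJ (idealM idJ 'X_j IHN) Ja.
    by rewrite mulrDr -exprS addrACA addrA addrK.
  exists (msize a); have := JX (msize a).
  by rewrite pihomog_large // addr0.
(* the successor makes the statement hold also when there are no variables *)
exists (\sum_j N j).+1 => m deg_m.
have [j ltNm] : exists j, (N j <= m j)%N.
  apply/existsP; rewrite -[[exists _, _]]negbK negb_exists.
  apply/negP => /forallP ltmN.
  have : (mdeg m <= \sum_j N j)%N.
    by rewrite mdegE; apply: leq_sum => j _; rewrite ltnW // ltnNge ltmN.
  by rewrite deg_m ltnn.
have -> : 'X_[m] = 'X_[m - U_(j) *+ N j] * 'X_j ^+ N j :> {mpoly K[n]}.
  rewrite mpolyXn -mpolyXD submK //.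
  apply/mnm_lepP => i; rewrite mulmnE mnm1E.
  by case: eqP => [<-|_]; rewrite ?mul1n ?mul0n.
exact: idealM.
Qed.

(** * Integrality of a function with enough denominators *)

Lemma coef_eq0_of_roots (K : closedFieldType) (p : {poly K}) :
  (forall t, t != 0 -> p.[t] = 0) -> p = 0.
Proof.
move=> p0; apply/eqP/negPn/negP => nz_p.
have nz_Xp : 'X * p != 0 by rewrite mulf_neq0 ?polyX_eq0.
have /closed_nonrootP[t] := nz_Xp.
rewrite rootE hornerM hornerX mulf_eq0 negb_or => /andP[/p0-> ].
by rewrite eqxx.
Qed.

(** Rescaling v by t multiplies the d-th component by t^d, and a polynomial
    identity in t valid for all nonzero t holds coefficientwise. *)
Lemma component_eq (K : closedFieldType) (m : nat) (p q : {mpoly K[m]})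
    (v : 'I_m -> K) (z : K) (d : nat) :
  (forall t, t != 0 -> z * p.@[fun i => t * v i] = q.@[fun i => t * v i]) ->
  z * (pihomog mdeg d p).@[v] = (pihomog mdeg d q).@[v].
Proof.
move=> eq_pq; pose N := maxn d.+1 (maxn (msize p) (msize q)).
have le_pN : (msize p <= N)%N by rewrite !leq_max leqnn orbT.
have le_qN : (msize q <= N)%N by rewrite !leq_max leqnn !orbT.
pose c k := z * (pihomog mdeg k p).@[v] - (pihomog mdeg k q).@[v].
have /polyP/(_ d) : \poly_(k < N) c k = 0.
  apply: coef_eq0_of_roots => t nz_t; rewrite horner_poly.
  apply: etrans (subrr (q.@[fun i => t * v i])); rewrite -{1}(eq_pq t nz_t).
  rewrite (meval_components _ _ le_pN) (meval_components _ _ le_qN) mulr_sumr -sumrB.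
  by apply: eq_bigr => k _; rewrite [c k * _]mulrC mulrBr mulrCA.
by rewrite coef_poly coef0 leq_max ltnSn => /eqP; rewrite subr_eq0 => /eqP.
Qed.

Section Integrality.
Variables (K : closedFieldType) (n m : nat).
Local Notation A := {mpoly K[n]}.
Local Notation B := {mpoly {mpoly K[n]}[m]}.

(** Polynomials in two groups of variables are polynomials in the second group
    over the ring of polynomials in the first, so that the second degree and the
    matrices of coefficients over the first ring are directly available. *)
Definition bieval (E : B) (v1 : 'I_n -> K) (v2 : 'I_m -> K) : K :=
  (map_mpoly (meval v1) E).@[v2].

Lemma bievalD E F v1 v2 : bieval (E + F) v1 v2 = bieval E v1 v2 + bieval F v1 v2.
Proof. by rewrite /bieval raddfD mevalD. Qed.

Lemma bievalM E F v1 v2 : bieval (E * F) v1 v2 = bieval E v1 v2 * bieval F v1 v2.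
Proof. by rewrite /bieval rmorphM mevalM. Qed.

Lemma map_pihomog v1 d (E : B) :
  map_mpoly (meval v1) (pihomog mdeg d E) = pihomog mdeg d (map_mpoly (meval v1) E).
Proof.
apply/mpolyP=> mm; rewrite mcoeff_map_mpoly !mcoeff_pihomog.
by case: ifP => _; [rewrite mcoeff_map_mpoly | exact: meval0].
Qed.

(** [Rel v1 v2 z] stands for: z is the value at (v1, v2) of a partially defined
    function. A relation on vectors avoids a choice of homogeneous coordinates,
    and asking for [fraction E F] at all rescalings of v2 is what makes the ideal
    of denominators homogeneous. *)
Variable Rel : ('I_n -> K) -> ('I_m -> K) -> K -> Prop.

Definition fraction (E F : B) : Prop :=
  forall v1 v2 z, Rel v1 v2 z -> z * bieval E v1 v2 = bieval F v1 v2.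

Definition denominators (u : 'I_n -> K) : set {mpoly K[m]} :=
  [set c | exists E F, map_mpoly (meval u) E = c /\ fraction E F].

Lemma ideal_denominators u : ideal (denominators u).
Proof.
split.
- exists 0, 0; split; first exact: raddf0.
  by move=> v1 v2 z _; rewrite /bieval raddf0 meval0 mulr0.
- move=> _ _ [E [F [<- EF]]] [E' [F' [<- EF']]]; exists (E + E'), (F + F').
  split=> [|v1 v2 z Rz]; first exact: raddfD.
  by rewrite !bievalD mulrDr (EF _ _ _ Rz) (EF' _ _ _ Rz).
- move=> a _ [E [F [<- EF]]]; pose a' : B := map_mpoly (@mpolyC n K) a.
  have a'K v : map_mpoly (meval v) a' = a.
    by apply/mpolyP=> mm; rewrite !mcoeff_map_mpoly /= mevalC.
  exists (a' * E), (a' * F); split=> [|v1 v2 z Rz]; first by rewrite rmorphM /= a'K.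
  by rewrite !bievalM mulrCA (EF _ _ _ Rz) /bieval.
Qed.

Hypothesis RelZ : forall v1 v2 z t,
  t != 0 -> Rel v1 v2 z -> Rel v1 (fun i => t * v2 i) z.

Lemma fraction_component E F d :
  fraction E F -> fraction (pihomog mdeg d E) (pihomog mdeg d F).
Proof.
move=> EF v1 v2 z Rz; rewrite /bieval !map_pihomog.
by apply: component_eq => t nz_t; apply: EF; apply: RelZ.
Qed.

Lemma pihomog_sum_monomials (R : comNzRingType) N (p : {mpoly R[m]}) :
  pihomog mdeg N p =
    \sum_(t : {b : 'X_{1..m < N.+1} | mdeg b == N}) p@_(val (val t)) *: 'X_[val (val t)].
Proof.
apply/mpolyP=> mm; rewrite mcoeff_pihomog raddf_sum /=.
case: eqP => [deg_mm|ne_deg]; last first.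
  rewrite big1 // => t _; rewrite mcoeffZ mcoeffX; case: eqP => [def_mm|_].
    by case: ne_deg; rewrite -def_mm (eqP (valP t)).
  by rewrite mulr0.
have lt_mm : (mdeg mm < N.+1)%N by rewrite deg_mm.
have deg_b : mdeg (BMultinom lt_mm) == N by rewrite /= deg_mm.
rewrite (bigD1 (exist _ (BMultinom lt_mm) deg_b)) //= mcoeffZ mcoeffX eqxx mulr1.
rewrite big1 ?addr0 // => t ne_t; rewrite mcoeffZ mcoeffX.
case: eqP => [def_mm|_]; last by rewrite mulr0.
by case/eqP: ne_t; apply/val_inj/val_inj.
Qed.

(** Multiplication by the function preserves the span of the monomials of a
    degree N, with coefficients rational in v1 and regular at u; hence the
    function is integral over the local ring at u, and at each v1 close to u its
    values are roots of a characteristic polynomial. *)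
Theorem integral_near (u : 'I_n -> K) : ~ countable [set: K] ->
    (forall v1 v2 z, Rel v1 v2 z -> exists i, v2 i != 0) ->
    (forall v, (exists i, v i != 0) -> exists2 c, denominators u c & c.@[v] != 0) ->
  exists2 D : A, D.@[u] != 0 & forall v1, D.@[v1] != 0 ->
    exists2 P : {poly K}, P != 0 & forall v2 z, Rel v1 v2 z -> root P z.
Proof.
move=> uncK Rel_nz noZ.
have homJ p d : denominators u p -> denominators u (pihomog mdeg d p).
  move=> [E [F [<- EF]]]; exists (pihomog mdeg d E), (pihomog mdeg d F).
  by rewrite map_pihomog; split=> //; apply: fraction_component.
have [N JN] := homogeneous_nullstellensatz uncK (ideal_denominators u) homJ noZ.
pose T := {b : 'X_{1..m < N.+1} | mdeg b == N}.
pose M := #|{: T}|; pose mon (i : 'I_M) : 'X_{1..m} := val (val (enum_val i : T)).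
have deg_mon i : mdeg (mon i) = N by apply/eqP/(valP (enum_val i : T)).
have inj_mon : injective mon by move=> i j /val_inj/val_inj/enum_val_inj.
have sum_mon (R : comNzRingType) (p : {mpoly R[m]}) :
    pihomog mdeg N p = \sum_i p@_(mon i) *: 'X_[mon i].
  rewrite pihomog_sum_monomials (reindex (@enum_val T predT)) //=.
  by exists enum_rank => t _; rewrite ?enum_valK ?enum_rankK.
have /choice[EF EFP] : forall i, exists EF : B * B,
    map_mpoly (meval u) EF.1 = 'X_[mon i] /\ fraction EF.1 EF.2.
  by move=> i; have [E [F EF]] := JN (mon i) (deg_mon i); exists (E, F).
pose P : 'M[A]_M := \matrix_(i, j) ((EF j).1)@_(mon i).
pose Q : 'M[A]_M := \matrix_(i, j) ((EF j).2)@_(mon i).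
pose e v : 'rV[K]_M := \row_i 'X_[mon i].@[v].
(* row vectors are used since eigenvectors act on the left of matrices *)
have evalE (H : 'I_M -> B) v1 v2 j :
    bieval (pihomog mdeg N (H j)) v1 v2 =
    (e v2 *m map_mx (meval v1) (\matrix_(i, k) (H k)@_(mon i))) 0 j.
  rewrite /bieval map_pihomog sum_mon raddf_sum mxE /=.
  by apply: eq_bigr => i _; rewrite mevalZ mulrC mcoeff_map_mpoly !mxE.
have Pu : map_mx (meval u) P = 1%:M.
  apply/matrixP=> i j; rewrite !mxE -mcoeff_map_mpoly (EFP j).1 mcoeffX eq_sym.
  by rewrite (inj_eq inj_mon).
exists (\det P) => [|v1]; first by rewrite -det_map_mx Pu det1 oner_eq0.
rewrite -det_map_mx -unitfE => unitP.
pose g := map_mx (meval v1) Q *m invmx (map_mx (meval v1) P).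
exists (char_poly g) => [|v2 z Rz]; first exact/monic_neq0/char_poly_monic.
rewrite -eigenvalue_root_char; apply/eigenvalueP; exists (e v2).
  rewrite mulmxA; apply: (canLR (mulmxK unitP)); rewrite -scalemxAl.
  have eP j := evalE (fun k => (EF k).1) v1 v2 j.
  have eQ j := evalE (fun k => (EF k).2) v1 v2 j.
  apply/rowP=> j; rewrite [RHS]mxE -[X in z * X]eP -[LHS]eQ.
  by apply/esym/(fraction_component _ (EFP j).2).
have [i nz_v2i] := Rel_nz _ _ _ Rz.
have deg_i : mdeg (U_(i) *+ N)%MM = N by rewrite mdegMn mdeg1 mul1n.
have lt_i : (mdeg (U_(i) *+ N)%MM < N.+1)%N by rewrite deg_i.
have deg_b : mdeg (BMultinom lt_i) == N by rewrite /= deg_i.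
apply/rV0Pn; exists (enum_rank (exist _ (BMultinom lt_i) deg_b : T)).
rewrite mxE /mon enum_rankK /= -mpolyXn rmorphXn /= mevalXU.
exact: expf_neq0.
Qed.

End Integrality.

(** * The Zariski topology of projective space *)

Lemma hval_scale (K : fieldType) (m d : nat) (p : {mpoly K[m]}) (c : K)
    (x : proj K m) :
  p \is d.-homog -> p.@[fun j => c * hcoord x 0 j] = c ^+ d * hval p x.
Proof. exact: meval_homog. Qed.

Lemma eval_mmap (R S : comNzRingType) (n : nat) (f : {rmorphism R -> S})
    (g : {rmorphism S -> R}) (h : 'I_n -> S) (p : {mpoly R[n]}) :
  cancel f g -> g (mmap f h p) = p.@[fun t => g (h t)].
Proof.
move=> fK; rewrite mevalE /mmap rmorph_sum; apply: eq_bigr => mm _ /=.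
rewrite rmorphM /= fK /mmap1 rmorph_prod; congr (_ * _).
by apply: eq_bigr => i _; rewrite rmorphXn.
Qed.

Lemma proj_eq (K : fieldType) (m : nat) (x y : proj K m) (c : K) :
  hcoord x = c *: hcoord y -> x = y.
Proof.
move=> def_x; apply/val_inj/eqP; rewrite !val_hcoord eqEdim !dim_vline.
rewrite !hcoord_neq0 leqnn andbT -memvE def_x.
by rewrite memvZ ?memv_line.
Qed.

Section ZariskiTopology.
Variables (K : closedFieldType) (m : nat).
Implicit Types (x y : proj K m) (X Z : set (proj K m)).

(** The common zeros of arbitrary polynomials on whole lines are those of their
    homogeneous components; so no homogeneity need be checked below for
    polynomials obtained by substitution or as determinants. *)
Lemma zariski_closed_cone (S : set {mpoly K[m]}) :
  zariski_closed
    [set x | forall p, S p -> forall c, p.@[fun j => c * hcoord x 0 j] = 0].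
Proof.
exists [set q | exists p d, S p /\ q = pihomog mdeg d p]; split.
  by move=> _ [p [d [_ ->]]]; exists d; apply: pihomogP.
apply/seteqP; split=> x /= Zx.
  move=> _ [p [d [Sp ->]]]; rewrite /hval -[LHS]mul1r.
  rewrite (component_eq (q := 0)) ?pihomog0 ?meval0 // => t _.
  by rewrite Zx // mulr0 meval0.
move=> p Sp c; rewrite (meval_components _ _ (leqnn _)) big1 // => d _.
by rewrite [_.@[_]]Zx ?mulr0 //; exists p, d.
Qed.

(** A linear form vanishing at y; for fixed i with y_i nonzero, those forms cut
    out the point y. *)
Definition separating_form y (i j : 'I_m) : {mpoly K[m]} :=
  hcoord y 0 i *: 'X_j - hcoord y 0 j *: 'X_i.

Lemma separating_form_homog y i j : separating_form y i j \is 1.-homog.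
Proof. by rewrite rpredB // rpredZ // dhomogX /= mdeg1. Qed.

Lemma hval_separating_form y i j x :
  hval (separating_form y i j) x =
    hcoord y 0 i * hcoord x 0 j - hcoord y 0 j * hcoord x 0 i.
Proof. by rewrite /hval mevalB !mevalZ !mevalXU. Qed.

Lemma separating_formP y i x : hcoord y 0 i != 0 ->
  (forall j, hval (separating_form y i j) x = 0) -> x = y.
Proof.
move=> nz_yi x0; apply: (@proj_eq _ _ _ _ (hcoord x 0 i / hcoord y 0 i)).
apply/rowP=> j; rewrite !mxE; apply: (mulfI nz_yi).
have /eqP := x0 j; rewrite hval_separating_form subr_eq0 => /eqP ->.
by rewrite mulrA [X in _ = X * _]mulrC divfK // mulrC.
Qed.

Lemma zariski_closed_point y : zariski_closed [set y].
Proof.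
have /rV0Pn[i nz_yi] := hcoord_neq0 y.
exists [set q | exists j, q = separating_form y i j]; split.
  by move=> _ [j ->]; exists 1%N; apply: separating_form_homog.
apply/seteqP; split=> x /=.
  move=> -> _ [j ->]; rewrite hval_separating_form.
  by rewrite [X in X - _]mulrC subrr.
by move=> x0; apply: (separating_formP nz_yi) => j; apply: x0; exists j.
Qed.

Lemma zariski_closed_hypersurface d (q : {mpoly K[m]}) :
  q \is d.-homog -> zariski_closed [set x | hval q x = 0].
Proof.
move=> hom_q; exists [set q]; split=> [_ ->|]; first by exists d.
by apply/seteqP; split=> x /= => [qx _ -> //|]; apply.
Qed.

Lemma zariski_closed0 : zariski_closed (set0 : set (proj K m)).
Proof.
exists [set 1]; split=> [_ ->|]; first by exists 0%N; apply: dhomog1.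
apply/seteqP; split=> x //= /(_ 1 erefl).
by rewrite /hval meval1 => /eqP; rewrite oner_eq0.
Qed.

Lemma zariski_closedU Z1 Z2 :
  zariski_closed Z1 -> zariski_closed Z2 -> zariski_closed (Z1 `|` Z2).
Proof.
move=> [S1 [hom1 ->]] [S2 [hom2 ->]].
exists [set p | exists p1 p2, [/\ S1 p1, S2 p2 & p = p1 * p2]]; split.
  move=> _ [p1 [p2 [/hom1[d1 h1] /hom2[d2 h2] ->]]].
  by exists (d1 + d2)%N; apply: dhomogM.
apply/seteqP; split=> x /=.
  by case=> x0 _ [p1 [p2 [Sp1 Sp2 ->]]]; rewrite /hval mevalM;
    [rewrite [p1.@[_]]x0 ?mul0r | rewrite [p2.@[_]]x0 ?mulr0].
move=> x0; have [x1|/existsNP[p1 /not_implyP[Sp1 nz_p1x]]] :=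
  pselect (forall p, S1 p -> hval p x = 0); first by left.
right=> p2 Sp2; have : hval (p1 * p2) x = 0 by apply: x0; exists p1, p2.
rewrite /hval mevalM => /eqP; rewrite mulf_eq0 => /orP[/eqP//|/eqP//].
Qed.

Lemma irreducible_finite_cover X (I : eqType) (s : seq I) (Z : I -> set (proj K m)) :
  irreducible X -> (forall i, zariski_closed (Z i)) ->
  (forall x, X x -> exists2 i, i \in s & Z i x) ->
  exists i, X `<=` Z i.
Proof.
move=> [[x0 Xx0] irrX] closedZ.
elim: s => [|i s IHs] cover; first by have [] := cover x0 Xx0.
have closed_s : zariski_closed [set x | exists2 j, j \in s & Z j x].
  elim: (s) => [|j r IHr].
    rewrite (_ : mkset _ = set0); first exact: zariski_closed0.
    by apply/seteqP; split=> x [].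
  rewrite (_ : mkset _ = Z j `|` [set x | exists2 j, j \in r & Z j x]).
    exact: zariski_closedU.
  apply/seteqP; split=> x /=.
    move=> [l]; rewrite inE => /orP[/eqP-> Zjx|rl Zlx]; first by left.
    by right; exists l.
  by case=> [Zjx|[l rl Zlx]]; [exists j|exists l]; rewrite // inE ?eqxx ?rl ?orbT.
have [|XZ|Xs] := irrX _ _ (closedZ i) closed_s; last 2 first.
- by exists i.
- exact: IHs.
move=> x /cover[j]; rewrite inE => /orP[/eqP->|sj] Zjx; first by left.
by right; exists j.
Qed.

(** A local expression g / h on an open set becomes an identity valid on all of
    A after multiplying g and h by a form s that vanishes off this open set but
    not at a. *)
Lemma regular_fraction (A : set (proj K m)) (phi : proj K m -> K) a :
  regular A phi -> A a ->
  exists (d : nat) (G H : {mpoly K[m]}), [/\ G \is d.-homog, H \is d.-homog,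
    hval H a != 0 & forall b, A b -> phi b * hval H b = hval G b].
Proof.
move=> reg_phi Aa.
have [U [[S [homS defU]] [Ua [d [g [h [hom_g hom_h phiE]]]]]]] := reg_phi a Aa.
have [s [Ss nz_sa]] : exists s, S s /\ hval s a != 0.
  apply: contrapT => Sa0; have : (~` U) a; last exact.
  rewrite defU => s Ss; apply/eqP/negPn/negP => nz_sa; apply: Sa0.
  by exists s.
have [e hom_s] := homS s Ss.
exists (d + e)%N, (g * s), (h * s); split; rewrite ?dhomogM //.
  by have [nz_h _] := phiE a Aa Ua; rewrite /hval mevalM mulf_neq0.
move=> b Ab; rewrite /hval !mevalM.
have [Ub|nUb] := pselect (U b).
  have [nz_hb ->] := phiE b Ab Ub.
  by rewrite mulrA divfK.
have : (~` U) b by [].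
by rewrite defU => /(_ s Ss); rewrite /hval => ->; rewrite !mulr0.
Qed.

End ZariskiTopology.

(** * Slices of the Segre embedding *)

Definition update (I : eqType) (T : Type) (w : I -> T) (i : I) (x : T) : I -> T :=
  fun j => if j == i then x else w j.

Lemma update_same (I : eqType) (T : Type) (w : I -> T) i x : update w i x i = x.
Proof. by rewrite /update eqxx. Qed.

Lemma update_other (I : eqType) (T : Type) (w : I -> T) i j x :
  j != i -> update w i x j = w j.
Proof. by rewrite /update => /negPf->. Qed.

Lemma updateC (I : eqType) (T : Type) (w : I -> T) i j x y : i != j ->
  update (update w i x) j y = update (update w j y) i x.
Proof.
move=> nij; apply/funext => l; rewrite /update.
by case: (l =P j) => [->|//]; rewrite eq_sym (negPf nij).
Qed.

Lemma update_id (I : eqType) (T : Type) (w : I -> T) i : update w i (w i) = w.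
Proof. by apply/funext => l; rewrite /update; case: eqP => [->|]. Qed.

Lemma update_in (I : eqType) (T : Type) (X : set T) (w : I -> T) i x :
  (forall j, X (w j)) -> X x -> forall j, X (update w i x j).
Proof. by move=> Xw Xx j; rewrite /update; case: eqP. Qed.

Section Slices.
Variables (K : closedFieldType) (n m : nat).
Implicit Types (w : 'I_n -> proj K m) (x : proj K m).

Lemma hcoord_segre w :
  exists2 c, c != 0 & forall t,
    hcoord (segre w) 0 t = c * segre_vec (fun i => hcoord (w i)) 0 t.
Proof.
have [c nz_c eq_c] := hcoord_pt (segre_vec_neq0 (fun i => hcoord_neq0 (w i))).
by exists c => // t; rewrite [hcoord _]eq_c mxE.
Qed.

Lemma hval_segre_scale w :
  exists2 b, b != 0 & forall d (p : {mpoly K[segre_size n m]}) c, p \is d.-homog ->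
    p.@[fun t => c * segre_vec (fun i => hcoord (w i)) 0 t]
      = (c / b) ^+ d * hval p (segre w).
Proof.
have [b nz_b segE] := hcoord_segre w.
exists b => // d p c hom_p; rewrite -(hval_scale _ _ hom_p); apply: meval_eq => t.
by rewrite segE mulrA divfK.
Qed.

(** Homogeneous coordinates of the Segre image are linear in each factor, so
    the equations of Z become polynomials in the coordinates of x. *)
Lemma zariski_closed_slice w i (Z : set (proj K (segre_size n m))) :
  zariski_closed Z -> zariski_closed [set x | Z (segre (update w i x))].
Proof.
move=> [S [homS ->]].
pose h (t : 'I_(segre_size n m)) : {mpoly K[m]} :=
  (\prod_(l | l != i) hcoord (w l) 0 (enum_val t l)) *: 'X_(enum_val t i).
pose pull p := mmap (@mpolyC m K) h p.
have pullE p x c : (pull p).@[fun j => c * hcoord x 0 j]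
    = p.@[fun t => c * segre_vec (fun l => hcoord (update w i x l)) 0 t].
  rewrite [LHS]eval_mmap => [|a]; last exact: mevalC.
  apply: meval_eq => t; rewrite /h /= mevalZ mevalXU mxE [in RHS](bigD1 i) //=.
  rewrite update_same mulrC -mulrA; congr (_ * (_ * _)).
  by apply: eq_bigr => l nli; rewrite update_other.
rewrite (_ : mkset _ = [set x | forall q, (exists2 p, S p & q = pull p) ->
    forall c, q.@[fun j => c * hcoord x 0 j] = 0]).
  exact: zariski_closed_cone.
apply/seteqP; split=> x /= Zx.
  move=> _ [p Sp ->] c; rewrite pullE; have [d hom_p] := homS p Sp.
  have [b _ pE] := hval_segre_scale (update w i x).
  by rewrite (pE _ _ _ hom_p) Zx ?mulr0.
move=> p Sp; have [d hom_p] := homS p Sp.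
have [b nz_b pE] := hval_segre_scale (update w i x).
have := Zx (pull p) _ b; rewrite pullE (pE _ _ _ hom_p) divff // expr1n mul1r; apply.
by exists p.
Qed.

Variables (X : set (proj K m)) (k : nat) (Y : set (proj K k)).
Variable f : proj K (segre_size n m) -> proj K k.
Hypothesis morph_f : morphism (prod_variety n X) Y f.

Lemma slice_preimage_closed w i (Z : set (proj K k)) :
  (forall j, X (w j)) -> zariski_closed Z ->
  exists2 Z', zariski_closed Z' &
    forall x, X x -> Z' x <-> Z (f (segre (update w i x))).
Proof.
move=> Xw closedZ; have [_ /(_ Z closedZ)[Z' closedZ' eqZ] _] := morph_f.
exists [set x | Z' (segre (update w i x))]; first exact: zariski_closed_slice.
move=> x Xx.
have Xwx : prod_variety n X (segre (update w i x)).
  by exists (update w i x) => //; apply: update_in.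
have /seteqP[sZ sZ'] := eqZ.
by split=> [Z'x|Zx]; [have [] := sZ' _ (conj Xwx Z'x) | have [] := sZ _ (conj Xwx Zx)].
Qed.

End Slices.

(** * The rigidity lemma *)

Section Rigidity.
Variables (K : closedFieldType) (n m k : nat).
Hypothesis uncountable_K : ~ countable [set: K].
Variables (X : set (proj K m)) (Y : set (proj K k)).
Variable f : proj K (segre_size n m) -> proj K k.
Hypotheses (X_variety : projective_variety X).
Hypothesis morph_f : morphism (prod_variety n X) Y f.
Variables (w : 'I_n -> proj K m) (i1 i2 : 'I_n) (p0 : proj K m) (y : proj K k).
Hypotheses (Xw : forall i, X (w i)) (ne_i12 : i1 != i2) (Xp0 : X p0).

Let wt x1 x2 := update (update w i1 x1) i2 x2.
Let F x1 x2 := f (segre (wt x1 x2)).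

Hypotheses (F1 : forall x1, X x1 -> F x1 p0 = y)
           (F2 : forall x2, X x2 -> F p0 x2 = y).

Let Xwt x1 x2 : X x1 -> X x2 -> forall i, X (wt x1 x2 i).
Proof. by move=> Xx1 Xx2; apply: update_in => //; apply: update_in. Qed.

Let Pwt x1 x2 : X x1 -> X x2 -> prod_variety n X (segre (wt x1 x2)).
Proof. by move=> Xx1 Xx2; exists (wt x1 x2) => //; apply: Xwt. Qed.

Local Notation B := {mpoly {mpoly K[m]}[m]}.

(** The t-th Segre coordinate as a function of the factors i1 and i2; [pull2]
    substitutes these functions into a form on the ambient space of X^n. *)
Let h2 (t : 'I_(segre_size n m)) : B :=
  ((\prod_(l | (l != i2) && (l != i1)) hcoord (w l) 0 (enum_val t l))
      *: 'X_(enum_val t i1))%:MP * 'X_(enum_val t i2).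

Let pull2 (p : {mpoly K[segre_size n m]}) : B :=
  mmap ((@mpolyC m {mpoly K[m]}) \o (@mpolyC m K)) h2 p.

(** The scalar b relates two choices of homogeneous coordinates. It is the same
    for all p, so it cancels in a quotient of forms of equal degree. *)
Lemma bieval_pull2 x1 x2 :
  exists2 b, b != 0 & forall d p a1 a2, p \is d.-homog ->
    bieval (pull2 p) (fun j => a1 * hcoord x1 0 j) (fun j => a2 * hcoord x2 0 j)
      = (a1 * a2 / b) ^+ d * hval p (segre (wt x1 x2)).
Proof.
have [b nz_b pE] := hval_segre_scale (wt x1 x2).
exists b => // d p a1 a2 hom_p; rewrite -(pE _ _ _ hom_p) /bieval.
set v1 := (fun j => a1 * _); set v2 := (fun j => a2 * _).
transitivity (((meval v2) \o (map_mpoly (meval v1))) (pull2 p)); first by [].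
rewrite eval_mmap => [|a]; last first.
  by rewrite /= map_mpolyC /= !mevalC.
apply: meval_eq => t; rewrite /h2 /= rmorphM /= map_mpolyC map_mpolyX mevalM mevalC /=.
rewrite mevalZ !mevalXU mxE [in RHS](bigD1 i2) //= [in RHS](bigD1 i1) //=.
rewrite {1 2}/wt update_same (update_other _ _ ne_i12) update_same.
under [in RHS]eq_bigr => l /andP[nl2 nl1] do rewrite /wt !update_other //.
set Q := \prod_(_ | _) _; rewrite -[LHS]mulrA [LHS]mulrC mulrACA -[LHS]mulrA.
congr (_ * _).
by rewrite mulrCA mulrA.
Qed.

Section Coordinate.
Variables i j : 'I_k.
Hypothesis nz_yi : hcoord y 0 i != 0.

Let l0 : {mpoly K[k]} := 'X_i.
Let l := separating_form y i j.
Let ratio (z : proj K k) := hval l z / hval l0 z.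

Let l0_homog : l0 \is 1.-homog. Proof. by rewrite dhomogX /= mdeg1. Qed.
Let l_homog : l \is 1.-homog. Proof. exact: separating_form_homog. Qed.

Let V := [set z : proj K k | hval l0 z != 0].

Let Vy : V y. Proof. by rewrite /V /= /hval mevalXU. Qed.

Let openV : zariski_open V.
Proof.
rewrite /zariski_open (_ : ~` V = [set z | hval l0 z = 0]).
  exact: zariski_closed_hypersurface l0_homog.
apply/seteqP; split=> z /=; first by move/negP/negPn/eqP.
by move=> z0; apply/negP; rewrite negbK z0.
Qed.

Let l0y : hval l0 y != 0 := Vy.

Let ly0 : hval l y = 0.
Proof. by rewrite hval_separating_form mulrC subrr. Qed.

Let regular_ratio : regular (prod_variety n X `&` f @^-1` V) (ratio \o f).
Proof.
have [_ _ pull_regular] := morph_f; apply: pull_regular => // z [_ Vz].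
exists V; split=> //; split=> //; exists 1%N, l, l0; split=> // z' _ Vz'.
Qed.

(** The graph of (l / l0) o f on the cones over the two factors. *)
Let Rel v1 v2 z := exists x1 x2 a1 a2,
  [/\ X x1, X x2, a2 != 0, V (F x1 x2) & z = ratio (F x1 x2)] /\
  v1 = (fun t => a1 * hcoord x1 0 t) /\ v2 = (fun t => a2 * hcoord x2 0 t).

Let uv1 : (fun t => 1 * hcoord p0 0 t) = (hcoord p0 0 : 'I_m -> K).
Proof. by apply/funext=> t; rewrite mul1r. Qed.

(** Over points of X the morphism property supplies a local fraction, which is
    defined because F p0 x2 = y is off the hyperplane l0 = 0; off X an equation
    of X is a denominator, with numerator 0. *)
Lemma denominator_nonzero (v : 'I_m -> K) : (exists t, v t != 0) ->
  exists2 c, denominators Rel (hcoord p0 0) c & c.@[v] != 0.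
Proof.
move=> [t nz_vt]; have nz_v : \row_s v s != 0.
  by apply/rV0Pn; exists t; rewrite mxE.
have [b nz_b hE] := hcoord_pt nz_v; set x2 := pt nz_v in hE.
have vE : v = fun s => b^-1 * hcoord x2 0 s.
  by apply/funext => s; rewrite hE !mxE mulKf.
have [Xx2|nXx2] := pselect (X x2).
  have Vx2 : V (f (segre (wt p0 x2))) by rewrite [f _]F2.
  have [d [G [H [hom_G hom_H nz_H GH]]]] :=
    regular_fraction regular_ratio (conj (Pwt Xp0 Xx2) Vx2).
  exists (map_mpoly (meval (hcoord p0 0)) (pull2 H)).
    exists (pull2 H), (pull2 G); split=> // v1 v2 z.
    move=> [z1 [z2 [a1 [a2 [[Xz1 Xz2 nz_a2 Vz ->] [-> ->]]]]]].
    have [e nz_e evE] := bieval_pull2 z1 z2.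
    rewrite [X in _ * X](evE d H a1 a2 hom_H) [RHS](evE d G a1 a2 hom_G).
    by rewrite mulrCA -(GH _ (conj (Pwt Xz1 Xz2) Vz)).
  rewrite vE -uv1 -/(bieval (pull2 H) _ _).
  have [e nz_e evE] := bieval_pull2 p0 x2; rewrite (evE d H 1 b^-1 hom_H).
  by rewrite mulf_neq0 // expf_neq0 // !mulf_neq0 ?oner_eq0 ?invr_eq0.
have [[S [homS defX]] _] := X_variety.
have [s [Ss nz_sx]] : exists s, S s /\ hval s x2 != 0.
  apply: contrapT => Sx0; apply: nXx2; rewrite defX => s Ss.
  by apply/eqP/negPn/negP => nz_sx; apply: Sx0; exists s.
have [d hom_s] := homS s Ss.
exists s; last by rewrite vE (hval_scale _ _ hom_s) mulf_neq0 ?expf_neq0 ?invr_eq0.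
have mapK v1 : map_mpoly (meval v1) (map_mpoly (@mpolyC m K) s) = s.
  by apply/mpolyP=> mm; rewrite !mcoeff_map_mpoly /= mevalC.
exists (map_mpoly (@mpolyC m K) s), 0; split; first exact: mapK.
move=> v1 v2 z [z1 [z2 [a1 [a2 [[_ Xz2 _ _ _] [_ ->]]]]]].
rewrite /bieval mapK raddf0 meval0 (hval_scale _ _ hom_s).
by move: Xz2; rewrite defX => /(_ s Ss) ->; rewrite !mulr0.
Qed.

(** For x1 near p0, X is covered by the closed sets where l0 o F x1 vanishes
    and by finitely many level sets of the ratio; by irreducibility one of them
    is X, and the point p0, where F x1 p0 = y, singles out the level 0. *)
Lemma ratio_eq0_near :
  exists2 D : {mpoly K[m]}, D.@[hcoord p0 0] != 0 &
    forall x1 c, X x1 -> D.@[fun t => c * hcoord x1 0 t] != 0 ->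
      forall x2, X x2 -> hval l (F x1 x2) = 0.
Proof.
have RelZ v1 v2 z t : t != 0 -> Rel v1 v2 z -> Rel v1 (fun s => t * v2 s) z.
  move=> nz_t [z1 [z2 [a1 [a2 [[Xz1 Xz2 nz_a2 Vz zE] [-> ->]]]]]].
  exists z1, z2, a1, (t * a2); split; first by split; rewrite ?mulf_neq0.
  by split=> //; apply/funext => s; rewrite mulrA.
have Rel_nz v1 v2 z : Rel v1 v2 z -> exists s, v2 s != 0.
  move=> [z1 [z2 [a1 [a2 [[_ _ nz_a2 _ _] [_ ->]]]]]].
  have /rV0Pn[s nz_s] := hcoord_neq0 z2.
  by exists s; apply: mulf_neq0.
have [D nz_D rootD] := integral_near RelZ uncountable_K Rel_nz denominator_nonzero.
exists D => // x1 c Xx1 /rootD[P nz_P rootP] x2 Xx2.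
(* [None] indexes the locus where l0 vanishes and [Some r] the level r *)
have [rs def_P] := closed_field_poly_normal P.
pose q (r : option K) : {mpoly K[k]} := if r is Some a then l - a *: l0 else l0.
have hom_q r : q r \is 1.-homog by case: r => [a|] //=; rewrite rpredB ?rpredZ.
have hval_q a z : hval (q (Some a)) z = hval l z - a * hval l0 z.
  by rewrite /hval mevalB mevalZ.
have closed_q r : zariski_closed [set z | hval (q r) z = 0].
  exact: zariski_closed_hypersurface (hom_q r).
have Xw1 : forall i, X (update w i1 x1 i) by apply: update_in.
have /choice[Z ZP] : forall r, exists Z, zariski_closed Z /\
    forall x, X x -> Z x <-> hval (q r) (F x1 x) = 0.
  move=> r; have [Z closedZ ZE] := slice_preimage_closed morph_f i2 Xw1 (closed_q r).
  by exists Z.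
have [_ irrX] := X_variety.
have [x Xx|r XZ] := irreducible_finite_cover (s := None :: map Some rs) irrX
    (fun r => (ZP r).1).
- have [Vx|/negP/negPn/eqP l0x] := pselect (V (F x1 x)); last first.
    by exists None; rewrite ?inE //; apply/(ZP None).2.
  have : root P (ratio (F x1 x)).
    apply: (rootP (fun t => 1 * hcoord x 0 t)).
    by exists x1, x, c, 1; split; first by split; rewrite ?oner_eq0.
  rewrite def_P rootZ ?lead_coef_eq0 // root_prod_XsubC => rs_r.
  exists (Some (ratio (F x1 x))); first by rewrite inE map_f.
  by apply/(ZP (Some _)).2 => //; rewrite hval_q /ratio divfK // subrr.
have := XZ _ Xp0; have := XZ _ Xx2.
move=> /(ZP r).2 -/(_ Xx2) x2r /(ZP r).2 -/(_ Xp0); rewrite F1 //.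
case: r x2r {XZ} => [a|]; last by move=> _ /= l0y0; move: l0y; rewrite l0y0 eqxx.
rewrite !hval_q ly0 => x2r /eqP; rewrite sub0r oppr_eq0 mulf_eq0 (negPf l0y) orbF.
by move=> /eqP a0; rewrite a0 mul0r subr0 in x2r.
Qed.

(** The closed condition l (F x1 x2) = 0 on x1 holds on a neighbourhood of p0,
    which is dense in the irreducible set X. *)
Lemma ratio_eq0 x1 x2 : X x1 -> X x2 -> hval l (F x1 x2) = 0.
Proof.
move=> Xx1 Xx2; have [D nz_D DE] := ratio_eq0_near.
have Xw2 : forall i, X (update w i2 x2 i) by apply: update_in.
have closed_l := zariski_closed_hypersurface l_homog.
have [Z closedZ ZE] := slice_preimage_closed morph_f i1 Xw2 closed_l.
have closedD := zariski_closed_cone [set D].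
have [_ [_ /(_ _ _ closedZ closedD)]] := X_variety.
have ZF x : X x -> Z x <-> hval l (F x x2) = 0.
  by move=> Xx; rewrite /F /wt updateC //; apply: ZE.
case=> [x Xx|XZ|XD].
- have [D0|/existsNP[c /eqP nz_Dc]] :=
    pselect (forall c, D.@[fun t => c * hcoord x 0 t] = 0); first by right=> _ ->.
  by left; apply/ZF => //; apply: DE nz_Dc _ Xx2.
- exact/ZF/XZ.
- by have := XD _ Xp0 D erefl 1; rewrite uv1 => D0; rewrite D0 eqxx in nz_D.
Qed.

End Coordinate.

(** Rigidity lemma: y is cut out by the linear forms of [separating_form], and
    each of them vanishes on the values of F. *)
Theorem rigidity x1 x2 : X x1 -> X x2 -> F x1 x2 = y.
Proof.
move=> Xx1 Xx2; have /rV0Pn[i nz_yi] := hcoord_neq0 y.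
by apply: (separating_formP nz_yi) => j; apply: ratio_eq0.
Qed.

End Rigidity.

(** * Birational morphisms contracting the diagonals *)

Lemma irreducible_subset_point (K : closedFieldType) (m : nat)
    (X : set (proj K m)) (d : nat) (x : proj K m) :
  dimension X d -> X `<=` [set x] -> d = 0%N.
Proof.
move=> [[Z [irrZ properZ]] _] Xx; case: d => // d in irrZ properZ *.
have [_ [[x0 Z0x0] _] ZX0] := irrZ 0%N (leq0n _).
have [_ _ ZX1] := irrZ 1%N isT.
have [_ []] := properZ 0%N isT.
by move=> z /ZX1/Xx ->; rewrite -(Xx _ (ZX0 _ Z0x0)).
Qed.

(** A constant map that is injective on a nonempty open set U of X^n makes U a
    point; then {w i} contains a nonempty open subset of the irreducible set X,
    and so it is X. *)
Lemma constant_not_birational (K : closedFieldType) (n m k d : nat)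
    (X : set (proj K m)) (Y : set (proj K k))
    (f : proj K (segre_size n m) -> proj K k) (y : proj K k) (i : 'I_n) :
  irreducible X -> dimension X d -> (0 < d)%N ->
  (forall w : 'I_n -> proj K m, (forall j, X (w j)) -> f (segre w) = y) ->
  ~ birational (prod_variety n X) Y f.
Proof.
move=> [_ irrX] dimX d_gt0 f_const.
move=> [U [V [openU _ [_ [[w Xw <-] Uw]] _ [_ [g [_ fK _]]]]]].
have gy w' : (forall j, X (w' j)) -> U (segre w') -> segre w' = g y.
  move=> Xw' Uw'; rewrite -(fK (segre w')) ?f_const //.
  by split=> //; exists w'.
have closedU := zariski_closed_slice w i openU.
have [x Xx|XU|Xwi] := irrX _ _ closedU (zariski_closed_point (w i)).
- have [Ux|nUx] := pselect (U (segre (update w i x))); last by left.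
  right; rewrite /= -[LHS](update_same w i).
  have Xwx := update_in i Xw Xx.
  have /segre_inj -> // : segre (update w i x) = segre w.
  by rewrite (gy _ Xwx Ux) (gy _ Xw Uw).
- by have := XU _ (Xw i); rewrite /= update_id; apply.
- by rewrite (irreducible_subset_point dimX Xwi) in d_gt0.
Qed.

Theorem theorem1p9 (R : realType) (m : nat) (X : set (proj R[i] m)) (d : nat)
    (X_variety : projective_variety X) (X_smooth : smooth X)
    (dim_X : dimension X d) (d_gt0 : (0 < d)%N) (n : nat) (n_ge3 : (3 <= n)%N) :
  ~ exists (k : nat) (Y : set (proj R[i] k))
           (f : proj R[i] (segre_size n m) -> proj R[i] k),
      [/\ projective_variety Y,
          projective_morphism (prod_variety n X) Y f,
          birational (prod_variety n X) Y f
        & forall i j : 'I_n, (i < j)%N ->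
            exists y : proj R[i] k, f @` pair_diagonal X i j = [set y]].
Proof.
move=> [k [Y [f [_ [morph_f _] birat contr]]]].
have [_ irrX] := X_variety; have [[x0 Xx0] _] := irrX.
pose i0 : 'I_n := Ordinal (leq_trans (isT : 0 < 3)%N n_ge3).
pose i1 : 'I_n := Ordinal (leq_trans (isT : 1 < 3)%N n_ge3).
pose i2 : 'I_n := Ordinal (leq_trans (isT : 2 < 3)%N n_ge3).
pose y := f (segre (fun _ : 'I_n => x0)).
have f_diag (i j : 'I_n) (w : 'I_n -> proj R[i] m) : (i < j)%N ->
    (forall l, X (w l)) -> w i = w j -> f (segre w) = y.
  move=> lt_ij Xw eq_w; have [z /seteqP[fz _]] := contr i j lt_ij.
  have diag_w w' : (forall l, X (w' l)) -> w' i = w' j -> f (segre w') = z.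
    move=> Xw' eq_w'; apply: fz; exists (segre w') => //; split; first by exists w'.
    by rewrite !projection_segre eq_w'.
  by rewrite diag_w // /y diag_w.
apply: (constant_not_birational (y := y) i0 irrX dim_X d_gt0) birat => w Xw.
have ne01 : i0 != i1 by [].
rewrite -[w](update_id w i0) -[X in segre X](update_id _ i1) update_other //.
apply: (rigidity (@uncountable_complex R) X_variety morph_f Xw ne01 (Xw i2)) => //.
- move=> x Xx; apply: (f_diag i1 i2) => //.
  by apply: update_in => //; apply: update_in.
- move=> x Xx; apply: (f_diag i0 i2) => //.
  by apply: update_in => //; apply: update_in.
Qed.
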